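(* Let $Y$ be a Banach space such that $\mathcal{B}$ or $\mathcal{J}\mathcal{T}$ coarsely embeds into $Y$, where $\mathcal{J}\mathcal{T}$ is the James tree space and $\mathcal{B}$ is its canonical predual. Then there exists $r\in\mathbb{N}$ such that $Y^{(r)}$, the dual of order $r$ of $Y$, is not separable.
   Context: James tree space: let $T=2^{<\omega}$ be the tree of all finite sequences with coefficients in $\{0,1\}$, with the order $s\le t$ if the sequence $t$ extends $s$. A segment of $T$ is any set of the form $\{s\in T: t\le s\le t'\}$ with $t\le t'$ in $T$. For a map $x:T\to\mathbb{R}$ put $\|x\|_{\mathcal{J}\mathcal{T}}=\sup\{(\sum_{i=1}^n(\sum_{s\in S_i}x(s))^2)^{1/2}\}$, where the supremum is taken over all finite families of pairwise disjoint segments $S_1,\dots,S_n$ of $T$. Then $\mathcal{J}\mathcal{T}=\{x:T\to\mathbb{R}:\|x\|_{\mathcal{J}\mathcal{T}}<\infty\}$ with the norm $\|\cdot\|_{\mathcal{J}\mathcal{T}}$. For $s\in T$, the coordinate functional $e_s^*\in\mathcal{J}\mathcal{T}^*$ is given by $e_s^*(x)=x(s)$. The space $\mathcal{B}$ is the closed linear span of $\{e_s^*:s\in T\}$ in $\mathcal{J}\mathcal{T}^*$ (its dual $\mathcal{B}^*$ is isometric to $\mathcal{J}\mathcal{T}$). Coarse embedding: for a map $f:M\to N$ between metric spaces and $t\in[0,\infty)$, put $\rho_f(t)=\inf\{d_N(f(x),f(y)):d_M(x,y)\ge t\}$ and $\omega_f(t)=\sup\{d_N(f(x),f(y)):d_M(x,y)\le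 t\}$ (with $\inf\emptyset=\infty$, $\sup\emptyset=0$). The map $f$ is a coarse embedding if $\omega_f(t)<\infty$ for every $t\in[0,\infty)$ and $\lim_{t\to\infty}\rho_f(t)=\infty$; $M$ coarsely embeds into $N$ if such an $f$ exists. *)

(* Defs.v *)
From HB Require Import structures.
From mathcomp Require Import all_boot all_order all_algebra.
From mathcomp Require Import all_classical all_reals all_analysis.
From mathcomp Require Import ring lra.

Set Implicit Arguments.
Unset Strict Implicit.
Unset Printing Implicit Defensive.

Import Order.TTheory GRing.Theory Num.Theory.
Import numFieldNormedType.Exports.

Local Open Scope classical_set_scope.
Local Open Scope ring_scope.

Definition separable_space (T : topologicalType) : Prop :=
  exists A : set T, countable A /\ dense A.

(* The metric space underlying a normed space, with the same convention      *)
(* mdist x y = `|y - x| as the library uses for R^o.                         *)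
Definition normed_metric (R : realType) (V : normedModType R) : Type := V.

Section normed_metric.
Context (R : realType) (V : normedModType R).

Let dist (x y : V) : R := `|y - x|.

Let dist_ge0 x y : 0 <= dist x y. Proof. exact: normr_ge0. Qed.

Let dist_positivity x y : dist x y = 0 -> x = y.
Proof. by move/normr0_eq0/eqP; rewrite subr_eq0 => /eqP. Qed.

Let ballEdist (x : V) (d : R) : ball x d = [set y | dist x y < d].
Proof. by rewrite -ball_normE; apply/seteqP; split=> y; rewrite /ball_/= distrC. Qed.

HB.instance Definition _ := PseudoMetric.copy (normed_metric V) V.
HB.instance Definition _ := @PseudoMetric_isMetric.Build R (normed_metric V)
  dist dist_ge0 dist_positivity ballEdist.

End normed_metric.

Section coarse_embedding.
Context (R : realType) (M N : metricType R).
Implicit Types (f : M -> N) (t : R).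
Local Open Scope ereal_scope.

(* ereal_inf set0 = +oo. *)
Definition compression f t : \bar R :=
  ereal_inf [set (mdist (f p.1) (f p.2))%:E |
             p in [set p : M * M | (t <= mdist p.1 p.2)%R]].

(* ereal_sup set0 = -oo, and the adjoined 0 makes the supremum over an empty *)
(* family 0; it is harmless otherwise since distances are nonnegative.       *)
Definition expansion f t : \bar R :=
  ereal_sup ([set 0] `|` [set (mdist (f p.1) (f p.2))%:E |
                          p in [set p : M * M | (mdist p.1 p.2 <= t)%R]]).

Definition coarse_embedding f : Prop :=
  (forall t, (0 <= t)%R -> expansion f t < +oo) /\
  compression f t @[t --> +oo%R] --> +oo.

Definition coarsely_embeds : Prop := exists f, coarse_embedding f.

End coarse_embedding.
Arguments coarsely_embeds {R} M N.

Section dual.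
Context (R : realType) (V : normedModType R).

Definition dual_pred : {pred V -> R^o} :=
  mem [set f : V -> R^o | linear f /\ continuous f].

Record dual := Dual {
  dual_fun :> V -> R^o;
  dual_funP : dual_fun \in dual_pred }.

HB.instance Definition _ := [isSub for dual_fun].
HB.instance Definition _ := [Choice of dual by <:].

Let dual_submod_closed : submod_closed dual_pred.
Proof.
split.
  apply/mem_set; split; first by move=> a x y; rewrite /GRing.zero/= scaler0 addr0.
  exact: cst_continuous.
move=> a f g /set_mem[lf cf] /set_mem[lg cg]; apply/mem_set; split.
  move=> b x y; rewrite [LHS](_ : _ = a * f (b *: x + y) + g (b *: x + y))//.
  rewrite lf lg [RHS](_ : _ = b * (a * f x + g x) + (a * f y + g y))//.
  rewrite !(_ : forall u v : R^o, u *: v = u * v)//; ring.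
move=> x; apply: (@continuousD _ _ _ (a \*: f) g); last exact: cg.
by apply: cvgZl_tmp; exact: cf.
Qed.

HB.instance Definition _ := GRing.isSubmodClosed.Build R (V -> R^o) dual_pred
  dual_submod_closed.
HB.instance Definition _ := [SubChoice_isSubLmodule of dual by <:].

Definition dual_norm (f : dual) : R :=
  sup [set `|f x| | x in [set x : V | `|x| <= 1]].

Lemma dual_linear (f : dual) : linear f.
Proof. by case: f => f /= /set_mem[]. Qed.

HB.instance Definition _ (f : dual) :=
  GRing.isLinear.Build R V R^o *:%R (dual_fun f) (dual_linear f).

Lemma dual_continuous (f : dual) : continuous f.
Proof. by case: f => f /= /set_mem[]. Qed.

Lemma dual_has_sup (f : dual) :
  has_sup [set `|f x| | x in [set x : V | `|x| <= 1]].
Proof.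
split; first by exists `|f 0|; exists 0 => //=; rewrite normr0.
have /bounded_funP /(_ 1)[M HM] : bounded_near (dual_fun f) (nbhs (0 : V)).
  exact/linear_bounded_continuous/dual_continuous.
by exists M => _ [x /= x1 <-]; exact: HM.
Qed.

Lemma dual_ub (f : dual) x : `|x| <= 1 -> `|f x| <= dual_norm f.
Proof.
move=> x1; apply: ub_le_sup; first exact: (dual_has_sup f).2.
by exists x.
Qed.

Lemma dual_norm_le (f : dual) M :
  (forall x, `|x| <= 1 -> `|f x| <= M) -> dual_norm f <= M.
Proof.
move=> fM; apply: ge_sup; first exact: (dual_has_sup f).1.
by move=> _ [x /= x1 <-]; exact: fM.
Qed.

Let dual_ler_normD (f g : dual) :
  dual_norm (f + g) <= dual_norm f + dual_norm g.
Proof.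
apply: dual_norm_le => x x1; rewrite (le_trans (ler_normD _ _))//.
by rewrite lerD ?dual_ub.
Qed.

Let dual_normZ_le (a : R) (f : dual) :
  dual_norm (a *: f) <= `|a| * dual_norm f.
Proof.
apply: dual_norm_le => x x1.
by rewrite [X in `|X|](_ : _ = a * f x)// normrM ler_wpM2l ?dual_ub.
Qed.

Let dual_normZ (a : R) (f : dual) : dual_norm (a *: f) = `|a| * dual_norm f.
Proof.
have [->|a0] := eqVneq a 0.
  apply/eqP; rewrite eq_le dual_normZ_le normr0 mul0r/=.
  by rewrite (le_trans _ (@dual_ub _ 0 _)) ?normr0.
apply/eqP; rewrite eq_le dual_normZ_le/= -ler_pdivlMl ?normr_gt0//.
by rewrite -normfV (le_trans _ (dual_normZ_le _ _))// scalerA mulVf// scale1r.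
Qed.

Let dual_norm0_eq0 (f : dual) : dual_norm f = 0 -> f = 0.
Proof.
move=> f0; apply/val_inj/funext => x /=.
have [->|x0] := eqVneq x 0; first by rewrite linear0.
have := dual_ub f (x := `|x|^-1 *: x).
rewrite normrZ normfV normr_id mulVf ?normr_eq0// lexx f0 => /(_ isT).
rewrite normr_le0 linearZ/= /GRing.scale/=.
by rewrite mulf_eq0 invr_eq0 normr_eq0 (negbTE x0)/= => /eqP.
Qed.

HB.instance Definition _ := @Lmodule_isNormed.Build R dual
  dual_norm dual_ler_normD dual_normZ dual_norm0_eq0.

End dual.

Fixpoint iter_dual (R : realType) (r : nat) (V : normedModType R) :
    normedModType R :=
  if r is r'.+1 then dual (iter_dual r' V) else V.

Section closed_span.
Context (R : realType) (V : normedModType R) (A : set V).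

Definition lin_span : set V :=
  [set v | exists (n : nat) (a : 'I_n -> R) (w : 'I_n -> V),
     (forall i, A (w i)) /\ v = \sum_(i < n) a i *: w i].

Definition closed_span_pred : {pred V} := mem (closure lin_span).

(* The closed linear span of A as a normed space for the norm induced by V.  *)
Record closed_span := ClosedSpan {
  closed_span_val :> V;
  closed_span_valP : closed_span_val \in closed_span_pred }.

HB.instance Definition _ := [isSub for closed_span_val].
HB.instance Definition _ := [Choice of closed_span by <:].

Lemma lin_span_linear (a : R) (u v : V) :
  lin_span u -> lin_span v -> lin_span (a *: u + v).
Proof.
move=> [m [b [w [Aw ->]]]] [n [c [z [Az ->]]]].
exists (m + n)%N,
  (fun i => match fintype.split i with inl j => a * b j | inr j => c j end),
  (fun i => match fintype.split i with inl j => w j | inr j => z j end).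
split; first by move=> i; case: (fintype.split i).
rewrite big_split_ord/= scaler_sumr; congr (_ + _); apply: eq_bigr => i _.
  by rewrite (unsplitK (inl i)) scalerA.
by rewrite (unsplitK (inr i)).
Qed.

Let closed_span_submod_closed : submod_closed closed_span_pred.
Proof.
split.
  apply/mem_set/subset_closure; exists 0%N, (fun=> 0), (fun=> 0).
  by split; [case|rewrite big_ord0].
move=> a u v /set_mem cu /set_mem cv; apply/mem_set => B.
have c : continuous (fun p : V * V => a *: p.1 + p.2).
  move=> p; apply: (@continuousD _ _ _ (fun p : V * V => a *: p.1) snd).
    by apply: cvgZl_tmp; exact: cvg_fst.
  exact: cvg_snd.
move=> /(c (u, v)) [[C D] /= [Cu Dv] CD].
have [u' [lu Cu']] := cu _ Cu; have [v' [lv Dv']] := cv _ Dv.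
exists (a *: u' + v'); split; first exact: lin_span_linear.
exact: (CD (u', v')).
Qed.

HB.instance Definition _ := GRing.isSubmodClosed.Build R V closed_span_pred
  closed_span_submod_closed.
HB.instance Definition _ := [SubChoice_isSubLmodule of closed_span by <:].

Definition closed_span_norm (x : closed_span) : R := `|closed_span_val x|.

Let closed_span_ler_normD x y :
  closed_span_norm (x + y) <= closed_span_norm x + closed_span_norm y.
Proof. exact: ler_normD. Qed.

Let closed_span_normZ (a : R) x :
  closed_span_norm (a *: x) = `|a| * closed_span_norm x.
Proof. exact: normrZ. Qed.

Let closed_span_norm0_eq0 x : closed_span_norm x = 0 -> x = 0.
Proof. by move=> /normr0_eq0 x0; exact: val_inj. Qed.

HB.instance Definition _ := @Lmodule_isNormed.Build R closed_span
  closed_span_norm closed_span_ler_normD closed_span_normZ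
  closed_span_norm0_eq0.

End closed_span.

Section James_tree.
Context (R : realType).
Local Notation T := (seq bool).

Definition segment (t t' : T) : set T := [set s | prefix t s /\ prefix s t'].

Definition is_segment (S : set T) : Prop :=
  exists t t' : T, prefix t t' /\ S = segment t t'.

Lemma finite_is_segment S : is_segment S -> finite_set S.
Proof.
move=> [t [t' [_ ->]]].
apply: (@sub_finite_set _ _ ((fun n => take n t') @` `I_(size t').+1)).
  move=> s [_ /prefixP[u ->]] /=; exists (size s).
    by rewrite /= ltnS size_cat leq_addr.
  by rewrite take_size_cat.
exact/finite_image/finite_II.
Qed.

Definition JT_sum (n : nat) (S : 'I_n -> set T) (x : T -> R^o) : R :=
  Num.sqrt (\sum_(i < n) (\sum_(s \in S i) x s) ^+ 2).

(* Segments are nonempty, so that trivIset means pairwise disjoint.          *)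
Definition JT_enorm (x : T -> R^o) : \bar R :=
  ereal_sup [set r | exists (n : nat) (S : 'I_n -> set T),
    [/\ forall i, is_segment (S i), trivIset [set: 'I_n] S &
        r = (JT_sum S x)%:E]].

Definition JT_pred : {pred T -> R^o} :=
  mem [set x : T -> R^o | (JT_enorm x < +oo)%E].

Record JT := JamesTree {
  JT_fun :> T -> R^o;
  JT_funP : JT_fun \in JT_pred }.

HB.instance Definition _ := [isSub for JT_fun].
HB.instance Definition _ := [Choice of JT by <:].

Lemma l2_ler_normD n (a b : 'I_n -> R) :
  Num.sqrt (\sum_(i < n) (a i + b i) ^+ 2) <=
  Num.sqrt (\sum_(i < n) a i ^+ 2) + Num.sqrt (\sum_(i < n) b i ^+ 2).
Proof.
have s0 (c : 'I_n -> R) : 0 <= \sum_(i < n) c i ^+ 2.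
  by apply: sumr_ge0 => i _; exact: sqr_ge0.
have z (c : 'I_n -> R) : Num.sqrt (\sum_(i < n) c i ^+ 2) = 0 ->
    forall i, c i = 0.
  move=> /eqP; rewrite sqrtr_eq0 => c0 i.
  have /eqP : \sum_(i < n) c i ^+ 2 = 0 by apply/eqP; rewrite eq_le c0 s0.
  rewrite psumr_eq0; last by move=> j _; exact: sqr_ge0.
  by move=> /allP/(_ i (mem_index_enum _)); rewrite /= sqrf_eq0 => /eqP.
set A := Num.sqrt (\sum_(i < n) a i ^+ 2).
set B := Num.sqrt (\sum_(i < n) b i ^+ 2).
have A2 : A ^+ 2 = \sum_(i < n) a i ^+ 2 by rewrite sqr_sqrtr.
have B2 : B ^+ 2 = \sum_(i < n) b i ^+ 2 by rewrite sqr_sqrtr.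
have A0 : 0 <= A by exact: sqrtr_ge0.
have B0 : 0 <= B by exact: sqrtr_ge0.
have [/z a0|An0] := eqVneq A 0.
  by under eq_bigr do rewrite a0 add0r; rewrite -/B lerDr.
have [/z b0|Bn0] := eqVneq B 0.
  by under eq_bigr do rewrite b0 addr0; rewrite -/A lerDl.
rewrite -[leRHS]ger0_norm ?addr_ge0// -sqrtr_sqr ler_wsqrtr//.
have AB0 : 0 < A * B by rewrite mulr_gt0// lt0r ?An0 ?Bn0.
rewrite -(ler_pM2l AB0) mulr_sumr.
have -> : A * B * (A + B) ^+ 2 =
    (A + B) * B * A ^+ 2 + (A + B) * A * B ^+ 2 by ring.
rewrite [in X in _ <= X + _]A2 [in X in _ <= _ + X]B2 !mulr_sumr -big_split/=.
apply: ler_sum => i _; rewrite -subr_ge0.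
rewrite [leRHS](_ : _ = (B * a i - A * b i) ^+ 2) ?sqr_ge0//; ring.
Qed.

Lemma JT_sum_ge0 n (S : 'I_n -> set T) x : 0 <= JT_sum S x.
Proof. exact: sqrtr_ge0. Qed.

Lemma JT_sumD n (S : 'I_n -> set T) x y : (forall i, is_segment (S i)) ->
  JT_sum S (x + y) <= JT_sum S x + JT_sum S y.
Proof.
move=> hS; rewrite /JT_sum (le_trans _ (l2_ler_normD _ _))//.
rewrite le_eqVlt; apply/orP; left; apply/eqP; congr Num.sqrt.
apply: eq_bigr => i _; congr (_ ^+ 2).
by rewrite -fsbig_split//; exact: finite_is_segment.
Qed.

Lemma JT_sumZ n (S : 'I_n -> set T) a x : (forall i, is_segment (S i)) ->
  JT_sum S (a *: x) = `|a| * JT_sum S x.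
Proof.
move=> hS; rewrite /JT_sum -sqrtr_sqr -sqrtrM ?sqr_ge0//; congr Num.sqrt.
rewrite mulr_sumr; apply: eq_bigr => i _; rewrite -exprMn; congr (_ ^+ 2).
by rewrite !fsbig_finite ?mulr_sumr//; exact: finite_is_segment.
Qed.

Lemma JT_enorm_ub x n (S : 'I_n -> set T) :
  (forall i, is_segment (S i)) -> trivIset [set: 'I_n] S ->
  ((JT_sum S x)%:E <= JT_enorm x)%E.
Proof. by move=> hS tS; apply: ereal_sup_ubound; exists n, S. Qed.

Lemma JT_enorm_ge0 x : (0 <= JT_enorm x)%E.
Proof.
pose S (i : 'I_0) : set T := set0.
apply: le_trans (@JT_enorm_ub x 0 S _ _).
- by rewrite lee_fin JT_sum_ge0.
- by case.
- by case.
Qed.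

Lemma JT_enormD x y : (JT_enorm (x + y)%R <= JT_enorm x + JT_enorm y)%E.
Proof.
apply: ge_ereal_sup => _ [n [S [hS tS ->]]].
apply: (@le_trans _ _ ((JT_sum S x)%:E + (JT_sum S y)%:E)%E).
  by rewrite -EFinD lee_fin JT_sumD.
by apply: leeD; exact: JT_enorm_ub.
Qed.

Lemma JT_enormZ a x : (JT_enorm (a *: x)%R <= `|a|%:E * JT_enorm x)%E.
Proof.
apply: ge_ereal_sup => _ [n [S [hS tS ->]]].
by rewrite JT_sumZ// EFinM lee_wpmul2l// JT_enorm_ub.
Qed.

Let JT_submod_closed : submod_closed JT_pred.
Proof.
split.
  apply/mem_set => /=; have <- := scale0r (0 : T -> R^o).
  by rewrite (le_lt_trans (JT_enormZ _ _))// normr0 mul0e.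
move=> a x y /set_mem/= x1 /set_mem/= y1; apply/mem_set => /=.
rewrite (le_lt_trans (JT_enormD _ _))// lte_add_pinfty//.
by rewrite (le_lt_trans (JT_enormZ _ _))// lte_mul_pinfty.
Qed.

HB.instance Definition _ := GRing.isSubmodClosed.Build R (T -> R^o) JT_pred
  JT_submod_closed.
HB.instance Definition _ := [SubChoice_isSubLmodule of JT by <:].

Definition JT_norm (x : JT) : R := fine (JT_enorm x).

Lemma JT_normE (x : JT) : (JT_norm x)%:E = JT_enorm x.
Proof.
by rewrite /JT_norm fineK// ge0_fin_numE ?JT_enorm_ge0//; case: x => x /= /set_mem.
Qed.

Let JT_ler_normD (x y : JT) : JT_norm (x + y) <= JT_norm x + JT_norm y.
Proof. by rewrite -lee_fin EFinD !JT_normE JT_enormD. Qed.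

Let JT_normZ_le (a : R) (x : JT) : JT_norm (a *: x) <= `|a| * JT_norm x.
Proof. by rewrite -lee_fin EFinM !JT_normE JT_enormZ. Qed.

Let JT_normZ (a : R) (x : JT) : JT_norm (a *: x) = `|a| * JT_norm x.
Proof.
have [->|a0] := eqVneq a 0.
  apply/eqP; rewrite eq_le JT_normZ_le normr0 mul0r/=.
  by rewrite -lee_fin JT_normE JT_enorm_ge0.
apply/eqP; rewrite eq_le JT_normZ_le/= -ler_pdivlMl ?normr_gt0//.
by rewrite -normfV (le_trans _ (JT_normZ_le _ _))// scalerA mulVf// scale1r.
Qed.

Lemma JT_coord_le (x : JT) (s : T) : `|x s| <= JT_norm x.
Proof.
rewrite -lee_fin JT_normE.
pose S (i : 'I_1) : set T := segment s s.
have segE : segment s s = [set s].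
  apply/seteqP; split=> [u [/prefixP[v ->] /prefixP[w /(congr1 size)]]|_ ->/=].
    rewrite !size_cat => /eqP; rewrite -addnA -[eqbLHS]addn0 eqn_add2l eq_sym.
    by rewrite addn_eq0 => /andP[/nilP -> _]; rewrite cats0.
  by split; exact: prefix_refl.
apply: le_trans (@JT_enorm_ub x 1 S _ _).
- by rewrite lee_fin /JT_sum big_ord1 /S segE fsbig_set1 sqrtr_sqr.
- by move=> i; exists s, s; split=> //; exact: prefix_refl.
- by move=> i j _ _ _; rewrite !ord1.
Qed.

Let JT_norm0_eq0 (x : JT) : JT_norm x = 0 -> x = 0.
Proof.
move=> x0; apply/val_inj/funext => s /=; apply/eqP.
by rewrite -normr_le0 -x0 JT_coord_le.
Qed.

HB.instance Definition _ := @Lmodule_isNormed.Build R JT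
  JT_norm JT_ler_normD JT_normZ JT_norm0_eq0.

Let JT_coord_dual (s : T) : (fun x : JT => x s : R^o) \in @dual_pred R JT.
Proof.
apply/mem_set; have lin : linear (fun x : JT => x s : R^o) by [].
split=> //.
pose L := GRing.isLinear.Build R JT R^o *:%R _ lin.
pose g : {linear JT -> R^o} := HB.pack (fun x : JT => x s : R^o) L.
apply: (@bounded_linear_continuous R JT R^o g).
apply/bounded_funP => r; exists r => x; apply: le_trans; exact: JT_coord_le.
Qed.

(* The functional e_s^* of evaluation at s.                                  *)
Definition JT_coord (s : T) : dual JT := Dual (JT_coord_dual s).

(* The canonical predual of JT, a subspace of the dual of JT.                *)
Definition JT_predual : normedModType R := closed_span (range JT_coord).

End James_tree.

(* Main.v *)
Require Import Defs.
From HB Require Import structures.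
From mathcomp Require Import all_boot all_order all_algebra.
From mathcomp Require Import all_classical all_reals all_analysis.
From mathcomp Require Import ring lra zify.

Set Implicit Arguments.
Unset Strict Implicit.
Unset Printing Implicit Defensive.

Import Order.TTheory GRing.Theory Num.Theory.
Import numFieldNormedType.Exports.

Local Open Scope classical_set_scope.
Local Open Scope ring_scope.

(** The proof is Kalton's argument with interlaced indices. Write [k] for a
    large integer and let [b] range over the branches of the tree. To an
    increasing [k]-tuple [s] of levels one attaches a point [F b s] of the
    space, namely [k^(-1/2)] times the sum of the unit vectors at the nodes of
    [b] of levels [s_j] for the James tree space ([JT_family]), and [k^(-1/2)]
    times the sum of the initial segments of [b] below these levels, viewed as
    functionals, for the predual ([predual_family]). Two properties matter. If
    [s] and [t] interlace, [s_0 < t_0 < s_1 < t_1 < ...], then [F b s] and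
    [F b t] are at distance at most [2], whatever [k] is. If [b] and [c] are
    different branches and all levels are past the point where they split, then
    [F b t] and [F c t] are at distance at least [k^(1/2)].

    Let [h] be a coarse embedding into [Y], let [w] bound its variation at
    distance [2], and choose [k] such that distances at least [k^(1/2)] become at
    least [1 + 2 w]. The maps [h \o F b] are bounded functions of [k] integers with
    values in [Y]. Taking weak-star limits along a free ultrafilter, in the
    last integer, then in the one before, and so on, yields a point [z b] in the
    dual of order [2k] of [Y] ([iterated_limit]).

    The points [z b] are at distance at least [1] from each other. Indeed,
    choose for each [t] a functional [G t] of norm at most one that norms
    [h (F b t) - h (F c t)] ([norming_functional], the Hahn-Banach theorem). If
    [s] and [t] interlace, [G t] is at least [1 + 2 w - 2 w = 1] on
    [h (F b s) - h (F c s)], and this lower bound passes to iterated limits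
    taken alternately in the entries of [t] and of [s]. Limits of [G] in [t] are
    again functionals of norm at most one, so they exhibit the norm of
    [z b - z c] as at least [1] ([iterated_limit_ge]). As there are uncountably
    many branches, the dual of order [2k] is not separable
    ([coarse_obstruction]).

    The Hahn-Banach theorem is obtained from the fact that a minimal sublinear
    functional is linear ([minimal_sublinear_linear]). *)

(** * Norming functionals from minimal sublinear functionals *)

(** Homogeneity is asked only as an inequality for [t > 0]: the reverse
    inequality follows by applying it to [t^-1], and the form below is the one
    that passes to infima. *)
Definition sublinear (R : realType) (V : lmodType R) (p : V -> R) : Prop :=
  (forall x y, p (x + y) <= p x + p y) /\
  (forall (t : R) x, 0 < t -> p (t *: x) <= t * p x).

Lemma sublinear0 (R : realType) (V : lmodType R) (p : V -> R) :
  sublinear p -> p 0 = 0.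
Proof.
move=> [_ pZ]; have := pZ 2 0; have := pZ 2^-1 0.
rewrite !scaler0 invr_gt0 ltr0n => /(_ isT) h1 /(_ isT) h2; lra.
Qed.

Lemma sublinearN (R : realType) (V : lmodType R) (p : V -> R) x :
  sublinear p -> - p (- x) <= p x.
Proof.
by move=> sp; have := sp.1 x (- x); rewrite subrr (sublinear0 sp); lra.
Qed.

Lemma norm_sublinear (R : realType) (V : normedModType R) :
  sublinear (fun x : V => `|x|).
Proof.
split=> [x y|t x t0]; first exact: ler_normD.
by rewrite normrZ gtr0_norm.
Qed.

(** Infima over a family that is directed downwards, or closed under the
    operations below, preserve sublinearity. The same lemma produces the lower
    bound of a chain in Zorn's lemma and the functionals [slide p y]; the
    minorant [b] makes the infima finite. *)
Lemma inf_sublinear (R : realType) (V : lmodType R) (I : Type) (i0 : I)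
    (q : I -> V -> R) (b : V -> R) :
  (forall i x, b x <= q i x) ->
  (forall i j x y, exists k, q k (x + y) <= q i x + q j y) ->
  (forall i (t : R) x, 0 < t -> exists k, q k (t *: x) <= t * q i x) ->
  sublinear (fun x => inf (range (fun i => q i x))) /\
  (forall i x, inf (range (fun i => q i x)) <= q i x).
Proof.
move=> qb qD qZ.
have lb i x : inf (range (fun i => q i x)) <= q i x.
  apply: ge_inf; last by exists i.
  by exists (b x) => _ [j _ <-].
have ge x (c : R) : (forall i, c <= q i x) -> c <= inf (range (fun i => q i x)).
  move=> cq; apply: lb_le_inf; first by exists (q i0 x), i0.
  by move=> _ [i _ <-].
split=> //; split=> [x y|t x t0].
  rewrite -lerBlDl; apply: (ge y _ _) => j; rewrite lerBlDl -lerBlDr.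
  apply: (ge x _ _) => i; rewrite lerBlDr; have [k qk] := qD i j x y.
  exact: le_trans (lb k _) qk.
rewrite -ler_pdivrMl//; apply: (ge x _ _) => i; rewrite ler_pdivrMl//.
by have [k qk] := qZ i t x t0; exact: le_trans (lb k _) qk.
Qed.

Lemma exists_minimal_sublinear (R : realType) (V : lmodType R) (p : V -> R) :
  sublinear p -> exists q : V -> R, [/\ sublinear q, forall x, q x <= p x &
    forall r, sublinear r -> (forall x, r x <= q x) -> r = q].
Proof.
move=> sp.
pose T := {q : V -> R | sublinear q /\ forall x, q x <= p x}.
pose ord (q r : T) : bool := `[< forall x, sval r x <= sval q x >].
have lbT (q : T) x : - p (- x) <= sval q x.
  case: q => q [sq qp] /=; apply: le_trans (sublinearN x sq).
  by rewrite lerN2.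
have [| | | |[q [sq qp]] qmin] := @Zorn T ord.
- by move=> q; apply/asboolP.
- move=> q r s /asboolP qr /asboolP rs; apply/asboolP => x.
  exact: le_trans (qr x).
- move=> [q Hq] [r Hr] /asboolP /= qr /asboolP /= rq.
  apply/eq_exist/funext => x; apply/eqP.
  by rewrite eq_le qr rq.
- move=> A Atot; have [[q0 Aq0]|A0] := pselect (exists q, A q); last first.
    by exists (exist _ p (conj sp (fun=> lexx _))) => q Aq; case: A0; exists q.
  have tot (q r : {q | A q}) : exists s : {q | A q}, forall x,
      sval (sval s) x <= sval (sval q) x /\ sval (sval s) x <= sval (sval r) x.
    have [/asboolP h|/asboolP h] := Atot _ _ (svalP q) (svalP r).
      by exists r.
    by exists q.
  have [] := @inf_sublinear R V {q | A q} (exist _ q0 Aq0)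
    (fun q => sval (sval q)) (fun x => - p (- x)).
  + by move=> q x; exact: lbT.
  + move=> q r x y; have [s sqr] := tot q r; exists s.
    have [[sadd _] _] := svalP (sval s).
    by rewrite (le_trans (sadd _ _))// lerD//; have [] := sqr x; have [] := sqr y.
  + move=> q t x t0; exists q; have [[_ qZ] _] := svalP (sval q).
    exact: qZ.
  set r := (fun x => inf _) => sr rle.
  have rp x : r x <= p x.
    by rewrite (le_trans (rle (exist _ q0 Aq0) x))//; have [_] := svalP q0; apply.
  exists (exist _ r (conj sr rp)) => q Aq; apply/asboolP => x /=.
  exact: (rle (exist _ q Aq)).
exists q; split=> // r sr rq.
have rp x : r x <= p x by exact: le_trans (rq x) (qp x).
suff /qmin /(congr1 sval) : ord (exist _ q (conj sq qp)) (exist _ r (conj sr rp)) by [].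
exact/asboolP.
Qed.

(** The largest sublinear functional below [p] whose value at [- y] is at most
    [- p y]. It coincides with [p] when [p] is minimal, and this is what forces
    additivity. *)
Definition slide (R : realType) (V : lmodType R) (p : V -> R) (y x : V) : R :=
  inf (range (fun t : {nonneg R} => p (x + t%:num *: y) - t%:num * p y)).

Lemma slide_sublinear (R : realType) (V : lmodType R) (p : V -> R) y :
  sublinear p -> sublinear (slide p y) /\
  forall x t, 0 <= t -> slide p y x <= p (x + t *: y) - t * p y.
Proof.
move=> sp; have [pD pZ] := sp.
have pZ0 t x : 0 <= t -> t * p x <= p (t *: x).
  rewrite le_eqVlt => /predU1P[<-|t0]; first by rewrite mul0r scale0r sublinear0.
  rewrite -ler_pdivlMl//; have := pZ t^-1 (t *: x).
  by rewrite invr_gt0 scalerA mulVf ?gt_eqF// scale1r; apply.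
have [] := @inf_sublinear R V {nonneg R} 0%:nng
    (fun t x => p (x + t%:num *: y) - t%:num * p y) (fun x => - p (- x)).
- move=> t x; rewrite lerBrDr addrC lerBlDr (le_trans (pZ0 t%:num y _))//.
  by rewrite (le_trans _ (pD _ _))// addrAC subrr add0r.
- move=> s t u v; exists (s%:num + t%:num)%:nng => /=.
  rewrite scalerDl addrACA mulrDl [leRHS]addrACA -opprD lerD2r//.
- move=> s t x t0; have ts : 0 <= t * s%:num by rewrite mulr_ge0// ltW.
  exists (NngNum ts) => /=.
  by rewrite -scalerA -scalerDr mulrBr mulrA lerD2r pZ.
by move=> h1 h2; split=> // x t t0; have := h2 (NngNum t0) x.
Qed.

(** Minimality gives [slide q y = q], and the term [t = 1] of the infimum that
    defines [slide q y x] then reads [q x <= q (x + y) - q y], the inequality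
    opposite to subadditivity. *)
Lemma minimal_sublinear_linear (R : realType) (V : lmodType R) (q : V -> R) :
  sublinear q ->
  (forall r, sublinear r -> (forall x, r x <= q x) -> r = q) ->
  linear (q : V -> R^o).
Proof.
move=> sq qmin; have [qD qZ] := sq.
have add x y : q (x + y) = q x + q y.
  apply/eqP; rewrite eq_le qD/=; have [s1 s2] := slide_sublinear y sq.
  rewrite -lerBrDr -[X in X x <= _](qmin _ s1).
    by have := s2 x 1; rewrite scale1r mul1r; apply.
  by move=> z; have := s2 z 0; rewrite scale0r mul0r addr0 subr0; apply.
have opp x : q (- x) = - q x.
  by apply/eqP; rewrite -addr_eq0 -add addNr sublinear0.
have pos t x : 0 < t -> q (t *: x) = t * q x.
  move=> t0; apply/eqP; rewrite eq_le qZ//=.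
  rewrite -ler_pdivlMl//; have := qZ t^-1 (t *: x).
  by rewrite invr_gt0 scalerA mulVf ?gt_eqF// scale1r; apply.
have hom (a : R) x : q (a *: x) = a * q x.
  have [a0|a0|->] := ltgtP a 0; last by rewrite scale0r mul0r sublinear0.
    by rewrite -[a]opprK scaleNr opp pos ?oppr_gt0// !mulNr.
  exact: pos.
by move=> a x y; rewrite add hom.
Qed.

Lemma bounded_linear_dual (R : realType) (V : normedModType R)
    (L : V -> R^o) (C : R) :
  linear L -> (forall x, `|L x| <= C * `|x|) ->
  exists phi : dual V, forall x, phi x = L x.
Proof.
move=> linL LC.
have LV : L \in @dual_pred R V; last by exists (Dual LV).
apply/mem_set; split=> //.
pose B := GRing.isLinear.Build R V R^o *:%R _ linL.
pose g : {linear V -> R^o} := HB.pack L B.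
apply: (@bounded_linear_continuous R V R^o g).
apply/bounded_funP => r; exists (`|C| * r) => x xr; rewrite (le_trans (LC x))//.
by rewrite (le_trans (ler_wpM2r _ (ler_norm C)))// ler_wpM2l.
Qed.

(** The consequence of the Hahn-Banach theorem that serves here. A linear
    functional below [slide `|_| x0] is below the norm, and it is at most
    [- `|x0|] at [- x0], so that it attains the norm at [x0]. *)
Lemma norming_functional (R : realType) (V : normedModType R) (x0 : V) :
  exists phi : dual V, (forall x, `|phi x| <= `|x|) /\ phi x0 = `|x0|.
Proof.
have [s1 s2] := slide_sublinear x0 (@norm_sublinear R V).
have [q [sq qs qmin]] := exists_minimal_sublinear s1.
have qlin := minimal_sublinear_linear sq qmin.
have qn x : q x <= `|x|.
  rewrite (le_trans (qs x))//; have := s2 x 0.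
  by rewrite scale0r mul0r addr0 subr0; apply.
have qN x : q (- x) = - q x.
  have := qlin (-1) x 0; rewrite addr0 scaleN1r => ->.
  by rewrite sublinear0// addr0 scaleN1r.
have qnorm x : `|q x| <= `|x|.
  by rewrite ler_norml qn andbT lerNl -qN -normrN qn.
have [phi phiq] : exists phi : dual V, forall x, phi x = q x.
  by apply: (@bounded_linear_dual _ _ q 1 qlin) => x; rewrite mul1r.
exists phi; split=> [x|]; first by rewrite phiq.
(* At [- x0] the term [t = 1] of the infimum is [`|- x0 + x0| - `|x0|]. *)
apply/eqP; rewrite phiq eq_le qn/= -[q x0]opprK -qN lerNr (le_trans (qs _))//.
by have := s2 (- x0) 1; rewrite scale1r addNr normr0 mul1r add0r; apply.
Qed.

(** * The canonical embedding into the bidual *)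
Lemma dual_norm_ub (R : realType) (V : normedModType R) (phi : dual V) (x : V) :
  `|phi x| <= `|phi| * `|x|.
Proof.
have [->|x0] := eqVneq x 0; first by rewrite linear0 !normr0 mulr0.
have := @dual_ub R V phi (`|x|^-1 *: x).
rewrite normrZ normfV normr_id mulVf ?normr_eq0// lexx => /(_ isT).
rewrite linearZ/= [X in `|X| <= _ -> _]/(_ * _) normrM normfV normr_id.
by rewrite mulrC ler_pdivrMr ?normr_gt0.
Qed.

Lemma dual_norm_bound (R : realType) (V : normedModType R) (phi : dual V) C :
  0 <= C -> (forall x, `|phi x| <= C * `|x|) -> `|phi| <= C.
Proof.
move=> C0 phiC; apply: (@dual_norm_le R V) => x x1.
by rewrite (le_trans (phiC x))// -[leRHS]mulr1 ler_wpM2l.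
Qed.

Lemma exists_bidual (R : realType) (V : normedModType R) (x : V) :
  exists w : dual (dual V), forall phi, w phi = phi x.
Proof.
apply: (@bounded_linear_dual R (dual V) (fun phi => phi x) `|x|) => // phi.
by rewrite mulrC dual_norm_ub.
Qed.

Definition bidual (R : realType) (V : normedModType R) (x : V) : dual (dual V) :=
  sval (cid (exists_bidual x)).

Lemma bidualE (R : realType) (V : normedModType R) (x : V) (phi : dual V) :
  bidual x phi = phi x.
Proof. exact: (svalP (cid (exists_bidual x))). Qed.

Lemma bidual_norm_le (R : realType) (V : normedModType R) (x : V) :
  `|bidual x| <= `|x|.
Proof.
by apply: dual_norm_bound => // phi; rewrite bidualE mulrC dual_norm_ub.
Qed.

Lemma bidualB (R : realType) (V : normedModType R) (x y : V) :
  bidual (x - y) = bidual x - bidual y.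
Proof.
apply/val_inj/funext => phi; rewrite [LHS](bidualE (x - y) phi).
rewrite [RHS](_ : _ = bidual x phi - bidual y phi)//.
by rewrite !bidualE linearB.
Qed.

(** * Limits along a free ultrafilter *)
Lemma exists_free_ultrafilter :
  exists U : set_system nat, UltraFilter U /\ \oo `<=` U.
Proof. exact: ultraFilterLemma. Qed.

Definition free_ultrafilter : set_system nat := sval (cid exists_free_ultrafilter).

Global Instance free_ultrafilter_ultra : UltraFilter free_ultrafilter.
Proof. by have [] := svalP (cid exists_free_ultrafilter). Qed.

Lemma free_ultrafilter_ge N : free_ultrafilter [set n | (N <= n)%N].
Proof.
have [_] := svalP (cid exists_free_ultrafilter); apply.
exact: nbhs_infty_ge.
Qed.

Definition ulim (R : realType) (u : nat -> R) : R := lim (u @ free_ultrafilter).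

Lemma ultra_fmap (T U : Type) (f : T -> U) (F : set_system T) :
  UltraFilter F -> UltraFilter (f @ F).
Proof.
move=> FU; split; first exact: fmap_proper_filter.
move=> G GF FG; apply/seteqP; split=> A; last exact: FG.
move=> GA; have [//|FA] := in_ultra_setVsetC (f @^-1` A) FU.
have GnA : G (~` A) by exact: FG.
by have /filter_ex[x []] : G (A `&` ~` A) by exact: filterI.
Qed.

(** Bounded sequences live in a compact interval, on which ultrafilters
    converge. *)
Lemma cvg_ulim (R : realType) (u : nat -> R) C : (forall n, `|u n| <= C) ->
  u n @[n --> free_ultrafilter] --> ulim u.
Proof.
move=> uC; have := @segment_compact R (- C) C; rewrite compact_ultra.
have uU := ultra_fmap u free_ultrafilter_ultra.
move=> /(_ (u @ free_ultrafilter) uU)[].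
  by apply: nearW => n /=; rewrite in_itv/= -ler_norml.
by move=> l [_ /= ul]; apply/cvg_ex; exists l.
Qed.

Lemma ulim_ge (R : realType) (u : nat -> R) C c N : (forall n, `|u n| <= C) ->
  (forall n, (N <= n)%N -> c <= u n) -> c <= ulim u.
Proof.
move=> uC cu; apply: (cvgr_to_ge (cvg_ulim uC)).
exact: filterS (free_ultrafilter_ge N).
Qed.

Lemma ulim_norm (R : realType) (u : nat -> R) C : (forall n, `|u n| <= C) ->
  `|ulim u| <= C.
Proof.
move=> uC; have := cvg_ulim uC => uU.
rewrite ler_norml (cvgr_to_ge uU) ?(cvgr_to_le uU)//;
  by apply: nearW => n; have := uC n; rewrite ler_norml => /andP[].
Qed.

Lemma ulim_linear (R : realType) (u v : nat -> R) (C D a : R) :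
  (forall n, `|u n| <= C) -> (forall n, `|v n| <= D) ->
  ulim (fun n => a * u n + v n) = a * ulim u + ulim v.
Proof.
move=> uC vD; apply: cvg_lim => //.
by apply: cvgD; [apply: cvgM; [exact: cvg_cst|exact: cvg_ulim uC]|exact: cvg_ulim vD].
Qed.

(** The weak-star limit along the ultrafilter. It exists for norm-bounded
    sequences; the default [0] covers the sequences whose pointwise limits do
    not form a bounded functional. *)
Definition wslim (R : realType) (V : normedModType R) (g : nat -> dual V) :
    dual V :=
  xget 0 [set w : dual V | forall x, w x = ulim (fun n => g n x)].

Lemma wslimE (R : realType) (V : normedModType R) (g : nat -> dual V) C x :
  (forall n, `|g n| <= C) -> wslim g x = ulim (fun n => g n x).
Proof.
move=> gC.
have gx y n : `|g n y| <= C * `|y|.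
  by rewrite (le_trans (dual_norm_ub _ _))// ler_wpM2r.
have : exists w : dual V, forall x, w x = ulim (fun n => g n x).
  apply: (@bounded_linear_dual R V (fun x => ulim (fun n => g n x)) C) => [a y z|y].
    rewrite -[RHS](ulim_linear a (gx y) (gx z)); congr ulim.
    by apply/funext => n; rewrite linearP.
  exact: ulim_norm.
by move=> [w wE]; rewrite /wslim; case: xgetP => [w' _ ->//|/(_ w)]; case.
Qed.

Lemma wslim_norm (R : realType) (V : normedModType R) (g : nat -> dual V) C :
  (forall n, `|g n| <= C) -> `|wslim g| <= C.
Proof.
move=> gC; apply: dual_norm_bound => [|x]; first exact: le_trans (gC 0%N).
rewrite (wslimE _ gC); apply: ulim_norm => n.
by rewrite (le_trans (dual_norm_ub _ _))// ler_wpM2r.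
Qed.

Lemma wslimB (R : realType) (V : normedModType R) (g h : nat -> dual V) C D :
  (forall n, `|g n| <= C) -> (forall n, `|h n| <= D) ->
  wslim (fun n => g n - h n) = wslim g - wslim h.
Proof.
move=> gC hD; apply/val_inj/funext => x.
rewrite [RHS](_ : _ = wslim g x - wslim h x)//.
have ghCD n : `|g n - h n| <= C + D.
  by rewrite (le_trans (ler_normB _ _))// lerD.
rewrite [LHS](wslimE x ghCD) (wslimE x gC) (wslimE x hD).
have gx n : `|g n x| <= C * `|x|.
  by rewrite (le_trans (dual_norm_ub _ _))// ler_wpM2r.
have hx n : `|h n x| <= D * `|x|.
  by rewrite (le_trans (dual_norm_ub _ _))// ler_wpM2r.
rewrite [RHS]addrC -mulN1r -(ulim_linear (-1) hx gx); congr ulim.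
by apply/funext => n; rewrite mulN1r addrC.
Qed.

(** * Iterated weak-star limits *)

(** The dual of order [2k], with the biduals taken from the inside so that
    functions of [k] integers can be handled by recursion on [k], replacing
    the space by its bidual at each step. *)
Fixpoint even_dual (R : realType) (k : nat) (V : normedModType R) :
    normedModType R :=
  if k is k'.+1 then even_dual k' (dual (dual V)) else V.

Lemma even_dualE (R : realType) k (V : normedModType R) :
  even_dual k V = iter_dual k.*2 V.
Proof.
have iterD n : forall V : normedModType R,
    iter_dual n (dual V) = iter_dual n.+1 V.
  by elim: n => //= n IH W; rewrite IH.
by elim: k V => //= k IH V; rewrite IH !iterD.
Qed.

(** The limit in the last of the integer arguments. The arguments come as a
    list of arbitrary length, which lets [last_limit] be iterated. *)
Definition last_limit (R : realType) (V : normedModType R) (f : seq nat -> V)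
    (s : seq nat) : dual (dual V) :=
  wslim (fun n => bidual (f (rcons s n))).

Fixpoint iterated_limit (R : realType) (k : nat) (V : normedModType R)
    (f : seq nat -> V) : even_dual k V :=
  match k with
  | 0 => f [::]
  | k'.+1 => iterated_limit k' (last_limit f)
  end.

Lemma last_limit_norm (R : realType) (V : normedModType R) (f : seq nat -> V) C :
  (forall s, `|f s| <= C) -> forall s, `|last_limit f s| <= C.
Proof.
move=> fC s; apply: wslim_norm => n.
exact: le_trans (bidual_norm_le _) (fC _).
Qed.

Lemma iterated_limitB (R : realType) k (V : normedModType R)
    (f g : seq nat -> V) C D :
  (forall s, `|f s| <= C) -> (forall s, `|g s| <= D) ->
  iterated_limit k (fun s => f s - g s) = iterated_limit k f - iterated_limit k g.
Proof.
elim: k V f g => [//|k IH] V f g fC gD /=.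
rewrite -(IH _ _ _ (last_limit_norm fC) (last_limit_norm gD)).
congr iterated_limit; apply/funext => s; rewrite /last_limit.
rewrite -(@wslimB _ _ _ _ C D); last 2 first.
- by move=> n; exact: le_trans (bidual_norm_le _) (fC _).
- by move=> n; exact: le_trans (bidual_norm_le _) (gD _).
by congr wslim; apply/funext => n; rewrite bidualB.
Qed.

(** [N <= s_0 < t_0 < s_1 < t_1 < ... < s_(k-1) < t_(k-1)]. The last condition
    is stated for all [i < j] and not just for consecutive indices, which
    spares transitivity arguments. *)
Definition interlaced (N k : nat) (s t : seq nat) : Prop :=
  [/\ size s = k, size t = k,
    forall j, (j < k)%N -> (N <= nth 0 s j < nth 0 t j)%N &
    forall i j, (i < j < k)%N -> (nth 0 t i < nth 0 s j)%N].

(** Interlaced pairs are extended by any two integers that are successively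
    large enough, so that a bound valid for all interlaced pairs survives when
    the limit in the last entry of [t] and then the limit in the last entry of
    [s] are taken. *)
Lemma interlaced_rcons N k s t : interlaced N k s t ->
  exists M, forall n m, (M <= n)%N -> (n < m)%N ->
    interlaced N k.+1 (rcons s n) (rcons t m).
Proof.
move=> [sk tk st ts]; exists (N + (\max_(i < k) nth 0 t i).+1)%N => n m Mn nm.
split; rewrite ?size_rcons ?sk ?tk//.
  move=> j; rewrite ltnS leq_eqVlt !nth_rcons sk tk => /predU1P[->|jk].
    by rewrite ltnn eqxx nm andbT (leq_trans _ Mn)// leq_addr.
  by rewrite jk st.
move=> i j; rewrite ltnS [(j <= k)%N]leq_eqVlt !nth_rcons sk tk.
move=> /andP[ij /predU1P[jk|jk]].
  have ik : (i < k)%N by rewrite -jk.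
  rewrite jk ltnn eqxx ik (leq_trans _ Mn)// ltn_addl// ltnS.
  exact: (@leq_bigmax _ (fun i : 'I_k => nth 0 t i) (Ordinal ik)).
by rewrite jk (ltn_trans ij jk) ts// ij.
Qed.

(** Pairing [f] with functionals [g] that depend on interlaced indices detects
    the norm of the iterated limit. In the step, the limit in the last index of
    [g] is a functional on [V] and the limit in the last index of [f] is an
    element of the bidual of [V]; the induction hypothesis is then applied in
    that bidual, to the image of the former in the third dual. *)
Lemma iterated_limit_ge (R : realType) k (V : normedModType R) N
    (f : seq nat -> V) (g : seq nat -> dual V) (C c : R) :
  (forall s, `|f s| <= C) -> (forall s, `|g s| <= 1) ->
  (forall s t, interlaced N k s t -> c <= g t (f s)) ->
  c <= `|iterated_limit k f|.
Proof.
elim: k V f g => [|k IH] V f g fC g1 cgf /=.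
  rewrite (le_trans (cgf [::] [::] _))//; first by split=> // i j /andP[].
  rewrite (le_trans (ler_norm _))// (le_trans (dual_norm_ub _ _))//.
  by rewrite -[leRHS]mul1r ler_wpM2r.
pose h t := wslim (fun m => g (rcons t m)).
have gt1 t m : `|g (rcons t m)| <= 1 by [].
have h1 t : `|h t| <= 1 by apply: wslim_norm.
apply: (IH _ _ (fun t => bidual (h t))) => [|t|s t].
- exact: last_limit_norm.
- exact: le_trans (bidual_norm_le _) (h1 t).
move=> /interlaced_rcons[M stM]; rewrite bidualE /last_limit.
have fb n : `|bidual (f (rcons s n))| <= C.
  exact: le_trans (bidual_norm_le _) (fC _).
rewrite (wslimE _ fb); apply: (@ulim_ge _ _ C _ M) => [n|n Mn].
  rewrite bidualE (le_trans (dual_norm_ub _ _))// (le_trans _ (fC (rcons s n)))//.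
  by rewrite -[leRHS]mul1r ler_wpM2r.
rewrite bidualE (wslimE _ (gt1 t)); apply: (@ulim_ge _ _ C _ n.+1) => m.
  rewrite (le_trans (dual_norm_ub _ _))// (le_trans _ (fC (rcons s n)))//.
  by rewrite -[leRHS]mul1r ler_wpM2r.
by move=> nm; apply: cgf; exact: stM.
Qed.

(** The functional [G t] norms [f t - g t]; since [f] and [g] vary by at most
    [w] between interlaced indices, it is still at least [c - 2 w] on
    [f s - g s], so that [iterated_limit_ge] applies to [f - g] and [G]. *)
Lemma iterated_limit_dist (R : realType) k (V : normedModType R) N
    (f g : seq nat -> V) (C D w c : R) :
  (forall s, `|f s| <= C) -> (forall s, `|g s| <= D) ->
  (forall s t, interlaced N k s t -> `|f t - f s| <= w) ->
  (forall s t, interlaced N k s t -> `|g t - g s| <= w) ->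
  (forall s t, interlaced N k s t -> c <= `|f t - g t|) ->
  c - (w + w) <= `|iterated_limit k f - iterated_limit k g|.
Proof.
move=> fC gD fw gw cfg; rewrite -(iterated_limitB _ fC gD).
have /choice[G HG] : forall t, exists phi : dual V,
    (forall x, `|phi x| <= `|x|) /\ phi (f t - g t) = `|f t - g t|.
  by move=> t; exact: norming_functional.
have fgb s : `|f s - g s| <= C + D.
  by rewrite (le_trans (ler_normB _ _))// lerD.
apply: (@iterated_limit_ge _ _ _ N _ G _ _ fgb) => [t|s t st].
  by apply: dual_norm_bound => // x; rewrite mul1r; exact: (HG t).1.
have -> : f s - g s = (f t - g t) - ((f t - f s) - (g t - g s)).
  by rewrite opprB addrA subrKA opprB addrC subrKA.
rewrite linearB/= (HG t).2 lerB ?(cfg s t)// (le_trans (ler_norm _))//.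
rewrite (le_trans ((HG t).1 _))// (le_trans (ler_normB _ _))// lerD//.
  exact: fw.
exact: gw.
Qed.

(** * An obstruction to coarse embeddings *)

(** A countable dense set would number the points [z b] injectively, against
    Cantor's diagonal argument. *)
Lemma separated_not_separable (R : realType) (Z : normedModType R)
    (z : (nat -> bool) -> Z) :
  (forall b c, b <> c -> 1 <= `|z b - z c|) -> ~ separable_space Z.
Proof.
move=> zsep [A [/countable_injP[i iA] dA]].
have /choice[a Ha] : forall b, exists x, A x /\ ball (z b) 2^-1 x.
  move=> b; have b2 : (0 : R) < 2^-1 by rewrite invr_gt0.
  have [||x [xb Ax]] := dA (ball (z b) 2^-1).
  - by exists (z b); exact: ballxx.
  - exact: ball_open.
  by exists x.
have ainj : injective (fun b => i (a b)).
  move=> b c ibc; apply: contrapT => /zsep; apply/negP; rewrite -ltNge.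
  have aA e : a e \in A by apply/mem_set; have [] := Ha e.
  have abc : a b = a c by exact: (iA _ _ (aA b) (aA c) ibc).
  have [_] := Ha b; have [_] := Ha c; rewrite -!ball_normE/= abc => hc hb.
  rewrite -(subrKA (a c)) (le_lt_trans (ler_normD _ _))// [X in _ + X]distrC.
  lra.
pose d n := ~~ `[< exists b, i (a b) = n /\ b n >].
have : ~~ d (i (a d)).
  by apply/negP => dn; move: (dn) => /asboolPn; apply; exists d.
by rewrite negbK => /asboolP[b [/ainj -> dn]]; move: (dn) => /asboolPn; apply; exists d.
Qed.

Lemma coarsely_embeds_bounds (R : realType) (X Y : normedModType R) :
  coarsely_embeds (normed_metric X) (normed_metric Y) ->
  exists h : X -> Y,
    (forall t : R, 0 <= t ->
      exists w : R, forall x y, `|y - x| <= t -> `|h y - h x| <= w) /\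
    (forall c : R, exists t : R, forall x y, t <= `|y - x| -> c <= `|h y - h x|).
Proof.
move=> [h [hexp hcomp]]; exists h; split.
  move=> t t0; have := hexp t t0; rewrite /expansion.
  set E := ereal_sup _ => Efin; exists (fine E) => x y xyt.
  have Eub : ((`|(h : X -> Y) y - (h : X -> Y) x|)%:E <= E)%E.
    by apply: ereal_sup_ubound; right; exists (x, y).
  have E0 : (0 <= E)%E by apply: ereal_sup_ubound; left.
  by rewrite -lee_fin fineK// ge0_fin_numE.
move=> c; have /cvgeyPge/(_ c)[M [_ hM]] := hcomp.
exists (M + 1) => x y xy; rewrite -lee_fin.
apply: (le_trans (hM (M + 1) _)); first by rewrite ltrDl.
by apply: ereal_inf_lbound; exists (x, y).
Qed.

(** The maps [F b] vary little along interlaced indices, uniformly in [k],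
    while distinct [b] are far apart when [k] is large. After composition with
    a coarse embedding the variation is at most [w] and the distance at least
    [1 + 2 w], so that the iterated limits, indexed by the Cantor set, are
    pairwise at distance at least [1] in the dual of order [2k]. *)
Lemma coarse_obstruction (R : realType) (X Y : normedModType R) :
  (forall k : nat, exists F : (nat -> bool) -> seq nat -> X,
    [/\ exists C : R, forall b s, `|F b s| <= C,
        forall b s t, interlaced 0 k s t -> `|F b t - F b s| <= 2 &
        forall b c, b <> c -> exists N, forall s t, interlaced N k s t ->
          Num.sqrt k%:R <= `|F b t - F c t| ]) ->
  coarsely_embeds (normed_metric X) (normed_metric Y) ->
  exists r : nat, (0 < r)%N /\ ~ separable_space (iter_dual r Y).
Proof.
move=> HF /coarsely_embeds_bounds[h [hexp hcomp]].
have [w hw] := hexp 2 (ler0n _ 2).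
have [t ht] := hcomp (1 + (w + w)).
pose k := (Num.bound (t ^+ 2)).+1.
have tk : t <= Num.sqrt k%:R.
  rewrite (le_trans (ler_norm t))// -sqrtr_sqr ler_wsqrtr// ltW//.
  by rewrite (lt_le_trans (archi_boundP (sqr_ge0 t)))// ler_nat.
have [F [[C FC] Fint Fsep]] := HF k.
exists k.*2; split; first by rewrite double_gt0.
rewrite -even_dualE.
apply: (@separated_not_separable _ _ (fun b => iterated_limit k (fun s => h (F b s)))).
have C0 : 0 <= C by exact: le_trans (FC (fun=> true) [::]).
have [D hD] := hexp C C0.
have hF b s : `|h (F b s)| <= D + `|h 0|.
  by rewrite -[h (F b s)](subrK (h 0)) (le_trans (ler_normD _ _))// lerD// hD// subr0.
move=> b c /Fsep[N FN]; rewrite -[1](addrK (w + w)).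
have weak s u : interlaced N k s u -> interlaced 0 k s u.
  by case=> sk uk su us; split=> // j /su/andP[].
apply: (@iterated_limit_dist _ _ _ N _ _ _ _ w _ (hF b) (hF c)) => s u su.
- by apply: hw; apply: Fint; exact: weak.
- by apply: hw; apply: Fint; exact: weak.
- by apply: ht; apply: le_trans (FN s u su).
Qed.

(** * Norms in the James tree space *)
Lemma JT_norm_le (R : realType) (x : JT R) (C : R) :
  (forall n (S : 'I_n -> set (seq bool)), (forall i, is_segment (S i)) ->
    trivIset [set: 'I_n] S -> JT_sum S x <= C) -> `|x| <= C.
Proof.
move=> xC; rewrite -[`|x|]/(JT_norm x) -lee_fin JT_normE.
by apply: ge_ereal_sup => _ [n [S [hS tS ->]]]; rewrite lee_fin xC.
Qed.

Lemma JT_norm_ge (R : realType) (x : JT R) n (S : 'I_n -> set (seq bool)) :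
  (forall i, is_segment (S i)) -> trivIset [set: 'I_n] S -> JT_sum S x <= `|x|.
Proof.
by move=> hS tS; rewrite -[`|x|]/(JT_norm x) -lee_fin JT_normE JT_enorm_ub.
Qed.

Lemma sum_at_most_one (R : realType) n (P : 'I_n -> bool) :
  (forall i j, P i -> P j -> i = j) -> \sum_(i < n) (P i)%:R <= 1 :> R.
Proof.
move=> P1; have [/existsP[i Pi]|/existsPn P0] := boolP [exists i, P i].
  rewrite (bigD1 i)//= Pi big1 ?addr0// => j ji.
  by case Pj: (P j) => //; rewrite (P1 j i) ?eqxx in ji.
by rewrite big1// => i _; rewrite (negbTE (P0 i)).
Qed.

Lemma sum_disjoint_le1 (R : realType) n (S : 'I_n -> set (seq bool)) u :
  trivIset [set: 'I_n] S -> \sum_(i < n) (u \in S i)%:R <= 1 :> R.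
Proof.
move=> tS; apply: sum_at_most_one => i j /set_mem ui /set_mem uj.
by apply: tS => //; exists u.
Qed.

Lemma segment_sum_delta (R : realType) (S : set (seq bool)) v :
  is_segment S -> \sum_(u \in S) ((u == v)%:R : R) = (v \in S)%:R.
Proof.
move=> hS; rewrite fsbig_finite/=; last exact: finite_is_segment.
have [vS|vS] := boolP (v \in S).
  rewrite (bigD1_seq v) ?fset_uniq//=; last first.
    by rewrite in_fset_set//; exact: finite_is_segment.
  by rewrite eqxx big1 ?addr0// => u /negbTE ->.
rewrite big_seq_cond big1// => u; rewrite andbT.
rewrite in_fset_set//; last exact: finite_is_segment.
by case: eqVneq => [->|//]; rewrite (negbTE vS).
Qed.

Lemma JT_sum_delta_le1 (R : realType) v n (S : 'I_n -> set (seq bool)) :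
  (forall i, is_segment (S i)) -> trivIset [set: 'I_n] S ->
  JT_sum S (fun u => (u == v)%:R : R^o) <= 1.
Proof.
move=> hS tS; rewrite -[leRHS]sqrtr1 ler_wsqrtr//.
apply: le_trans (sum_disjoint_le1 R v tS); apply: ler_sum => i _.
by rewrite segment_sum_delta// expr2; case: (v \in _); rewrite ?mulr1 ?mulr0.
Qed.

Lemma JT_delta_subproof (R : realType) (v : seq bool) :
  (fun u => (u == v)%:R : R^o) \in @JT_pred R.
Proof.
apply/mem_set; apply: (@le_lt_trans _ _ 1%:E); last exact: ltry.
by apply: ge_ereal_sup => _ [n [S [hS tS ->]]]; rewrite lee_fin JT_sum_delta_le1.
Qed.

Definition JT_delta (R : realType) (v : seq bool) : JT R :=
  JamesTree (JT_delta_subproof R v).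

Lemma JT_delta_norm (R : realType) v : `|JT_delta R v| <= 1.
Proof. by apply: JT_norm_le => n S hS tS; exact: JT_sum_delta_le1. Qed.

Definition segment_functional (R : realType) (S : set (seq bool)) (x : JT R) : R :=
  \sum_(u \in S) x u.

Lemma segment_functional_delta (R : realType) (S : set (seq bool)) k
    (c : R) (v w : 'I_k -> seq bool) : is_segment S ->
  segment_functional S
    (c *: \sum_(j < k) JT_delta R (v j) - c *: \sum_(j < k) JT_delta R (w j)) =
  c * \sum_(j < k) ((v j \in S)%:R - (w j \in S)%:R).
Proof.
move=> hS; have fS := finite_is_segment hS.
have LB x y : segment_functional S (x - y) =
    segment_functional S x - segment_functional S y.
  by rewrite /segment_functional !fsbig_finite// -sumrB.
have LZ x : segment_functional S (c *: x) = c * segment_functional S x.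
  by rewrite /segment_functional !fsbig_finite// mulr_sumr.
have Lsum (f : 'I_k -> JT R) : segment_functional S (\sum_(j < k) f j) =
    \sum_(j < k) segment_functional S (f j).
  apply: (big_morph (segment_functional S)) => [x y|].
    by rewrite /segment_functional !fsbig_finite// -big_split.
  by rewrite /segment_functional fsbig1.
rewrite -scalerBr LZ LB !Lsum sumrB; congr (_ * (_ - _)).
  by apply: eq_bigr => j _; exact: segment_sum_delta.
by apply: eq_bigr => j _; exact: segment_sum_delta.
Qed.

(** * Branches and segments *)
Lemma prefix_mkseq (b : nat -> bool) t n :
  prefix t (mkseq b n) = (t == mkseq b (size t)) && (size t <= n)%N.
Proof.
rewrite prefixE /mkseq -map_take take_iota; case: leqP => tn.
  by rewrite andbT eq_sym.
rewrite andbF; apply/eqP => /(congr1 size).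
by rewrite size_map size_iota => nt; rewrite nt ltnn in tn.
Qed.

Lemma mem_segment (t t' u : seq bool) :
  (u \in segment t t') = prefix t u && prefix u t'.
Proof. by apply/idP/andP => [/set_mem[]//|[tu ut]]; apply/mem_set. Qed.

(** A segment meets a branch in an interval of levels: the lower end of the
    segment either lies on the branch or not, and the nodes of the branch below
    the upper end form an initial part of the branch. *)
Lemma mkseq_in_segment (b : nat -> bool) S : is_segment S ->
  exists p q, (p <= q)%N /\ forall n, (mkseq b n \in S) = (p <= n < q)%N.
Proof.
move=> [t [t' [_ ->]]].
have ex : exists n, ~~ prefix (mkseq b n) t'.
  exists (size t').+1; apply/negP => /size_prefix.
  by rewrite size_mkseq ltnn.
case: (ex_minnP ex) => q qt' qmin.
have qE n : prefix (mkseq b n) t' = (n < q)%N.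
  apply/idP/idP => [nt|]; last first.
    by apply: contraLR => /qmin; rewrite -leqNgt.
  rewrite ltnNge; apply: contra qt' => qn; apply: prefix_trans nt.
  by rewrite prefix_mkseq size_mkseq eqxx qn.
have [tb|tb] := eqVneq t (mkseq b (size t)); last first.
  (* The segment avoids the branch, which the empty interval records. *)
  exists 0%N, 0%N; split=> // n.
  by rewrite mem_segment prefix_mkseq (negbTE tb) ltn0 andbF.
exists (size t), (maxn (size t) q); split; first exact: leq_maxl.
move=> n; rewrite mem_segment prefix_mkseq -tb eqxx qE/= leq_max.
by case: (leqP (size t) n).
Qed.

(** The levels of [t] and [s] alternate, so in any interval of levels they
    differ in number by at most one. An interval is a difference of two upper
    sets, and for the upper set of the levels [>= a] the difference is the
    number [U a] of indices [j] with [s_j < a <= t_j], which is [0] or [1]. *)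
Lemma interlaced_mem_segment (R : realType) k s t b (S : set (seq bool)) :
  interlaced 0 k s t -> is_segment S ->
  `|\sum_(j < k) ((mkseq b (nth 0%N t j) \in S)%:R
                 - (mkseq b (nth 0%N s j) \in S)%:R)| <= 1 :> R.
Proof.
move=> [_ _ st ts] /(mkseq_in_segment b)[p [q [pq bS]]].
pose U a : R := \sum_(j < k) (nth 0 s j < a <= nth 0 t j)%N%:R.
have U0 a : 0 <= U a by apply: sumr_ge0.
have U1 a : U a <= 1.
  apply: sum_at_most_one => i j /andP[si ti] /andP[sj tj]; apply/val_inj/eqP.
  case: (ltngtP i j) => // ij.
    have := ts i j; rewrite ij ltn_ord => /(_ isT); lia.
  have := ts j i; rewrite ij ltn_ord => /(_ isT); lia.
rewrite (_ : \sum_(j < k) _ = U p - U q); last first.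
  rewrite -sumrB; apply: eq_bigr => j _; rewrite !bS.
  have /andP[_ stj] := st j (ltn_ord j).
  move: (nth 0%N s j) (nth 0%N t j) stj => x y xy.
  rewrite [(x < p)%N]ltnNge [(q <= y)%N]leqNgt.
  case px: (p <= x)%N; case py: (p <= y)%N; case xq: (x < q)%N; case yq: (y < q)%N;
    rewrite /=; try lra; exfalso; lia.
by have := (U0 p, U0 q, U1 p, U1 q) => -[[[? ?] ?] ?]; rewrite ler_norml; lra.
Qed.

(** * Interlaced families in the James tree space *)
Lemma mkseq_diff_level (b c : nat -> bool) : b <> c ->
  exists N, forall n m, (N <= n)%N -> mkseq b n != mkseq c m.
Proof.
move=> bc; have [p bp] : exists p, b p != c p.
  apply: contrapT => h; apply: bc; apply/funext => p; apply/eqP.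
  by apply: contrapT => bcp; apply: h; exists p; apply/negP.
exists p.+1 => n m pn; apply/eqP => nm.
have : nth false (mkseq b n) p = nth false (mkseq c m) p by rewrite nm.
have nm' : n = m by have := congr1 size nm; rewrite !size_mkseq.
by rewrite -nm' !nth_mkseq// => /eqP; apply/negP.
Qed.

Lemma sqrtV_sqr (R : realType) k : (Num.sqrt k%:R : R)^-1 ^+ 2 = k%:R^-1.
Proof. by rewrite exprVn sqr_sqrtr. Qed.

Lemma sqrtV_mul (R : realType) k : (Num.sqrt k%:R : R)^-1 * k%:R = Num.sqrt k%:R.
Proof.
case: k => [|k]; first by rewrite sqrtr0 mulr0.
rewrite -[X in _ * X](@sqr_sqrtr R) // expr2 mulKf// gt_eqF// sqrtr_gt0 ltr0n//.
Qed.

(** The factor [k^(-1/2)] is the compromise for which a move to interlaced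
    indices costs a bounded amount, a sum of [2k] unit vectors of alternating
    signs on a branch having norm of order [k^(1/2)], whereas two distinct
    branches remain at distance [k * k^(-1/2)] because the [k] units on one
    branch add up along a segment. *)
Definition JT_family (R : realType) k (b : nat -> bool) (s : seq nat) : JT R :=
  (Num.sqrt k%:R)^-1 *: \sum_(j < k) JT_delta R (mkseq b (nth 0%N s j)).

Lemma JT_family_bound (R : realType) k b s : `|JT_family R k b s| <= Num.sqrt k%:R.
Proof.
rewrite normrZ normfV ger0_norm ?sqrtr_ge0// -[leRHS]sqrtV_mul.
rewrite ler_wpM2l ?invr_ge0 ?sqrtr_ge0// (le_trans (ler_norm_sum _ _ _))//.
rewrite (le_trans (ler_sum _ (fun j _ => JT_delta_norm R _)))//.
by rewrite sumr_const card_ord.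
Qed.

(** Each segment sum [z i] is at most [1] in absolute value, hence
    [z i ^+ 2 <= `|z i|], and disjoint segments contain at most [2k] of the
    nodes involved. *)
Lemma JT_family_interlaced (R : realType) k b s t : interlaced 0 k s t ->
  `|JT_family R k b t - JT_family R k b s| <= 2.
Proof.
move=> st; apply: JT_norm_le => n S hS tS.
pose z i : R := \sum_(j < k) ((mkseq b (nth 0%N t j) \in S i)%:R
                 - (mkseq b (nth 0%N s j) \in S i)%:R).
have z2 : \sum_(i < n) z i ^+ 2 <= k%:R * 2.
  apply: (@le_trans _ _ (\sum_(i < n) \sum_(j < k)
      ((mkseq b (nth 0%N t j) \in S i)%:R + (mkseq b (nth 0%N s j) \in S i)%:R))).
    apply: ler_sum => i _; have z1 := interlaced_mem_segment R b st (hS i).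
    rewrite -(real_normK (num_real (z i))) expr2 (le_trans (ler_piMr _ z1))//.
    rewrite (le_trans (ler_norm_sum _ _ _))//; apply: ler_sum => j _.
    by rewrite (le_trans (ler_normB _ _))// !ger0_norm.
  rewrite exchange_big/= mulr_natl -[k in _ *+ k]card_ord -sumr_const.
  by apply: ler_sum => j _; rewrite big_split/= lerD// sum_disjoint_le1.
have -> : JT_sum S (JT_family R k b t - JT_family R k b s) =
    Num.sqrt (\sum_(i < n) ((Num.sqrt k%:R)^-1 * z i) ^+ 2).
  rewrite /JT_sum; congr Num.sqrt; apply: eq_bigr => i _; congr (_ ^+ 2).
  exact: segment_functional_delta.
rewrite -[leRHS]ger0_norm// -sqrtr_sqr ler_wsqrtr//.
under eq_bigr do rewrite exprMn sqrtV_sqr.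
rewrite -mulr_sumr (le_trans (ler_wpM2l _ z2)) ?invr_ge0// mulrA.
case: (k) => [|k']; first by rewrite mulr0 mul0r exprn_ge0.
by rewrite mulVf// mul1r; lra.
Qed.

(** One segment suffices: it starts where the branch [b] has left the branch
    [c], and it contains the nodes of [b] and none of [c]. *)
Lemma JT_family_separated (R : realType) k b c : b <> c ->
  exists N, forall s t, interlaced N k s t ->
    Num.sqrt k%:R <= `|JT_family R k b t - JT_family R k c t|.
Proof.
move=> /mkseq_diff_level[N bcN]; exists N => s t [_ _ st _].
pose q := (N + \max_(j < k) nth 0 t j)%N.
pose S (i : 'I_1) := segment (mkseq b N) (mkseq b q).
have hS i : is_segment (S i).
  exists (mkseq b N), (mkseq b q); split=> //.
  by rewrite prefix_mkseq size_mkseq eqxx leq_addr.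
have tS : trivIset [set: 'I_1] S by move=> i j _ _ _; rewrite !ord1.
apply: le_trans (JT_norm_ge _ hS tS).
rewrite /JT_sum big_ord1 sqrtr_sqr (le_trans _ (ler_norm _))//.
rewrite [leRHS](segment_functional_delta (Num.sqrt k%:R)^-1
  (fun j => mkseq b (nth 0%N t j)) (fun j => mkseq c (nth 0%N t j)) (hS ord0)).
rewrite -[leLHS]sqrtV_mul ler_wpM2l ?invr_ge0 ?sqrtr_ge0//.
rewrite le_eqVlt; apply/orP; left; apply/eqP.
rewrite -[k in k%:R]card_ord -sumr_const; apply: eq_bigr => j _.
have /andP[Nsj sjtj] := st j (ltn_ord j).
rewrite !mem_segment !prefix_mkseq !size_mkseq eqxx (negbTE (bcN _ _ (leqnn N))).
rewrite (leq_trans Nsj (ltnW sjtj))/= eqxx/= subr0.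
rewrite (_ : (nth 0%N t j <= q)%N = true)//.
exact: leq_trans (@leq_bigmax _ (fun j : 'I_k => nth 0 t j) j) (leq_addl _ _).
Qed.

(** * Interlaced families in the predual *)
Lemma predual_coord_subproof (R : realType) (u : seq bool) :
  @JT_coord R u \in closed_span_pred (range (@JT_coord R)).
Proof.
apply/mem_set/subset_closure; exists 1%N, (fun=> 1), (fun=> JT_coord R u).
by split=> [_|]; [exists u|rewrite big_ord1 scale1r].
Qed.

Definition predual_coord (R : realType) (u : seq bool) : JT_predual R :=
  ClosedSpan (predual_coord_subproof R u).

Lemma dualDE (R : realType) (V : normedModType R) (f g : dual V) x :
  (f + g) x = f x + g x.
Proof. by []. Qed.

Lemma dualNE (R : realType) (V : normedModType R) (f : dual V) x :
  (- f) x = - f x.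
Proof. by []. Qed.

Lemma dualZE (R : realType) (V : normedModType R) a (f : dual V) x :
  (a *: f) x = a * f x.
Proof. by []. Qed.

Lemma closed_span_valD (R : realType) (V : normedModType R) (A : set V)
    (f g : closed_span A) :
  closed_span_val (f + g) = closed_span_val f + closed_span_val g.
Proof. by []. Qed.

Lemma closed_span_valN (R : realType) (V : normedModType R) (A : set V)
    (f : closed_span A) : closed_span_val (- f) = - closed_span_val f.
Proof. by []. Qed.

Lemma closed_span_valZ (R : realType) (V : normedModType R) (A : set V) a
    (f : closed_span A) : closed_span_val (a *: f) = a *: closed_span_val f.
Proof. by []. Qed.

Definition predual_eval (R : realType) (x : JT R) (f : JT_predual R) : R :=
  closed_span_val f x.

(** Evaluation at [x] is linear; [predual_eval] keeps the conversion between
    the two layers, closed span and dual, out of the computations that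
    follow. *)
Lemma predual_evalB (R : realType) (x : JT R) f g :
  predual_eval x (f - g) = predual_eval x f - predual_eval x g.
Proof. by rewrite /predual_eval closed_span_valD closed_span_valN dualDE dualNE. Qed.

Lemma predual_evalZ (R : realType) (x : JT R) a f :
  predual_eval x (a *: f) = a * predual_eval x f.
Proof. by rewrite /predual_eval closed_span_valZ dualZE. Qed.

Lemma predual_eval_sum (R : realType) (x : JT R) (I : Type) (r : seq I)
    (P : pred I) (F : I -> JT_predual R) :
  predual_eval x (\sum_(i <- r | P i) F i) = \sum_(i <- r | P i) predual_eval x (F i).
Proof.
apply: (big_morph (predual_eval x)) => [f g|].
  by rewrite /predual_eval closed_span_valD dualDE.
by rewrite -[0](subrr 0) predual_evalB subrr.
Qed.

Lemma predual_norm_bound (R : realType) (f : JT_predual R) C :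
  0 <= C -> (forall x, `|predual_eval x f| <= C * `|x|) -> `|f| <= C.
Proof. by move=> C0 fC; exact: (@dual_norm_bound R (JT R) (closed_span_val f)). Qed.

Lemma predual_norm_ge (R : realType) (f : JT_predual R) x :
  `|predual_eval x f| <= `|f| * `|x|.
Proof. exact: (@dual_norm_ub R (JT R) (closed_span_val f)). Qed.

Lemma sqr_sum_le (R : realType) k (a : 'I_k -> R) :
  (\sum_(j < k) a j) ^+ 2 <= k%:R * \sum_(j < k) a j ^+ 2.
Proof.
case: k a => [a|k a]; first by rewrite !big_ord0 expr0n mulr0.
set K : R := k.+1%:R; set s := \sum_(j < k.+1) a j.
set Q := \sum_(j < k.+1) a j ^+ 2.
have : 0 <= \sum_(j < k.+1) (K * a j - s) ^+ 2.
  by apply: sumr_ge0 => j _; exact: sqr_ge0.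
rewrite (eq_bigr (fun j => K ^+ 2 * a j ^+ 2 - (2 * K * s) * a j + s ^+ 2)).
  rewrite big_split/= sumrB -!mulr_sumr sumr_const card_ord -/s -/Q -mulr_natl -/K.
  rewrite (_ : _ - _ + _ = K * (K * Q - s ^+ 2)); last by ring.
  by rewrite pmulr_rge0 ?ltr0n// subr_ge0.
by move=> j _; ring.
Qed.

Lemma segment_mkseqE (b : nat -> bool) n m : (n < m)%N ->
  segment (mkseq b n) (mkseq b m.-1) = [set` [seq mkseq b i | i <- index_iota n m]].
Proof.
case: m => // m; rewrite ltnS/= => nm; apply/seteqP; split=> u /=.
  move=> [nu um]; apply/mapP; exists (size u).
    rewrite mem_index_iota; move: nu um => /size_prefix + /size_prefix.
    by rewrite !size_mkseq => -> /=; rewrite ltnS.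
  by move: um; rewrite prefix_mkseq => /andP[/eqP].
move=> /mapP[i]; rewrite mem_index_iota ltnS => /andP[ni im] ->.
by split; rewrite prefix_mkseq size_mkseq eqxx.
Qed.

Lemma mkseq_inj (b : nat -> bool) : injective (mkseq b).
Proof. by move=> n m /(congr1 size); rewrite !size_mkseq. Qed.

Lemma branch_sum (R : realType) (b : nat -> bool) n m (x : JT R) : (n < m)%N ->
  \sum_(u \in segment (mkseq b n) (mkseq b m.-1)) x u =
  \sum_(n <= i < m) x (mkseq b i).
Proof.
move=> nm; rewrite segment_mkseqE// -fsbig_seq.
  by rewrite big_map.
by rewrite (map_inj_uniq (@mkseq_inj b)) iota_uniq.
Qed.

(** The functional that sums over the nodes of the branch [b] at levels in
    [[n, m)]. *)
Definition predual_branch (R : realType) (b : nat -> bool) n m : JT_predual R :=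
  \sum_(n <= i < m) predual_coord R (mkseq b i).

(** The functionals sum over disjoint segments of one branch, so the
    Cauchy-Schwarz inequality compares their sum with the James tree norm. *)
Lemma predual_disjoint_norm (R : realType) k b (n m : 'I_k -> nat) :
  (forall j, (n j < m j)%N) -> (forall i j : 'I_k, (i < j)%N -> (m i <= n j)%N) ->
  `|\sum_(j < k) predual_branch R b (n j) (m j)| <= Num.sqrt k%:R.
Proof.
move=> nm mn; apply: predual_norm_bound; rewrite ?sqrtr_ge0// => x.
pose S j := segment (mkseq b (n j)) (mkseq b (m j).-1).
have SE j u : u \in S j -> exists2 i, (n j <= i < m j)%N & u = mkseq b i.
  rewrite /S segment_mkseqE// => /set_mem/= /mapP[i].
  by rewrite mem_index_iota; exists i.
have hS j : is_segment (S j).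
  exists (mkseq b (n j)), (mkseq b (m j).-1); split=> //.
  by rewrite prefix_mkseq size_mkseq eqxx; have := nm j; case: (m j).
have tS : trivIset [set: 'I_k] S.
  move=> i j _ _ [u [/mem_set/SE[p pi ->] /mem_set/SE[q qj /mkseq_inj pq]]].
  apply/val_inj/eqP; case: (ltngtP i j) => // /mn; lia.
apply: le_trans (ler_wpM2l (sqrtr_ge0 _) (JT_norm_ge x hS tS)).
rewrite -sqrtrM// -sqrtr_sqr ler_wsqrtr//.
rewrite (_ : predual_eval _ _ = \sum_(j < k) \sum_(u \in S j) x u) ?sqr_sum_le//.
rewrite predual_eval_sum; apply: eq_bigr => j _.
by rewrite branch_sum// predual_eval_sum.
Qed.

(** The dual counterpart of [JT_family]: initial segments of the branch replace
    their end points. Differences over interlaced indices are then sums over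
    [k] disjoint segments, of norm at most [k^(1/2)], and two branches are
    told apart by the unit vector at a node of one of them, on which all [k]
    initial segments count. *)
Definition predual_family (R : realType) k (b : nat -> bool) (s : seq nat) :
    JT_predual R :=
  (Num.sqrt k%:R)^-1 *: \sum_(j < k) predual_branch R b 0 (nth 0%N s j).

Lemma predual_branch_norm (R : realType) b n : `|predual_branch R b 0 n| <= 1.
Proof.
have [->|n0] := posnP n; first by rewrite /predual_branch big_geq// normr0.
have := @predual_disjoint_norm R 1 b (fun=> 0%N) (fun=> n).
by rewrite big_ord1 sqrtr1; apply=> // i j; rewrite !ord1.
Qed.

Lemma predual_family_bound (R : realType) k b s :
  `|predual_family R k b s| <= Num.sqrt k%:R.
Proof.
rewrite normrZ normfV ger0_norm ?sqrtr_ge0// -[leRHS]sqrtV_mul.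
rewrite ler_wpM2l ?invr_ge0 ?sqrtr_ge0// (le_trans (ler_norm_sum _ _ _))//.
rewrite (le_trans (ler_sum _ (fun j _ => predual_branch_norm R b _)))//.
by rewrite sumr_const card_ord.
Qed.

Lemma predual_family_interlaced (R : realType) k b s t : interlaced 0 k s t ->
  `|predual_family R k b t - predual_family R k b s| <= 1.
Proof.
move=> [_ _ st ts].
have -> : predual_family R k b t - predual_family R k b s =
    (Num.sqrt k%:R)^-1 *:
      \sum_(j < k) predual_branch R b (nth 0%N s j) (nth 0%N t j).
  rewrite /predual_family -scalerBr -sumrB; congr (_ *: _).
  apply: eq_bigr => j _; have /andP[_ /ltnW stj] := st j (ltn_ord j).
  by rewrite /predual_branch (big_cat_nat (leq0n _) stj)/= [LHS]addrC addKr.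
rewrite normrZ normfV ger0_norm ?sqrtr_ge0//.
have [k0|k0] := posnP k.
  by rewrite k0 sqrtr0 invr0 mul0r.
rewrite ler_pdivrMl ?sqrtr_gt0 ?ltr0n// mulr1; apply: predual_disjoint_norm.
  by move=> j; have /andP[] := st j (ltn_ord j).
by move=> i j ij; rewrite ltnW// ts// ij/=.
Qed.

Lemma predual_family_separated (R : realType) k b c : b <> c ->
  exists N, forall s t, interlaced N k s t ->
    Num.sqrt k%:R <= `|predual_family R k b t - predual_family R k c t|.
Proof.
move=> /mkseq_diff_level[N bcN]; exists N => s t [_ _ st _].
pose x := JT_delta R (mkseq b N).
apply: (@le_trans _ _ (`|predual_family R k b t - predual_family R k c t| * `|x|));
  last first.
  by rewrite ler_piMr// JT_delta_norm.
apply: le_trans (predual_norm_ge _ x); apply: le_trans (ler_norm _).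
rewrite predual_evalB !predual_evalZ !predual_eval_sum -mulrBr -sumrB -[leLHS]sqrtV_mul.
rewrite ler_wpM2l ?invr_ge0 ?sqrtr_ge0//.
rewrite le_eqVlt; apply/orP; left; apply/eqP.
rewrite -[k in k%:R]card_ord -sumr_const; apply: eq_bigr => j _.
have /andP[Nsj sjtj] := st j (ltn_ord j).
rewrite !predual_eval_sum.
rewrite [X in _ - X]big1 ?subr0; last first.
  move=> i _; rewrite [LHS](_ : _ = (mkseq c i == mkseq b N)%:R)//.
  by rewrite eq_sym (negbTE (bcN _ _ _)).
rewrite (bigD1_seq N) ?iota_uniq//=; last first.
  by rewrite mem_index_iota (leq_ltn_trans Nsj).
rewrite big1 ?addr0; last first.
  move=> i iN; rewrite [LHS](_ : _ = (mkseq b i == mkseq b N)%:R)//.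
  by rewrite (inj_eq (@mkseq_inj b)) (negbTE iN).
by rewrite [RHS](_ : _ = (mkseq b N == mkseq b N)%:R)// eqxx.
Qed.

Theorem theorem6p2 (R : realType) (Y : completeNormedModType R) :
  coarsely_embeds (normed_metric (JT_predual R)) (normed_metric Y) \/
  coarsely_embeds (normed_metric (JT R)) (normed_metric Y) ->
  exists r : nat, (0 < r)%N /\ ~ separable_space (iter_dual r Y).
Proof.
case=> emb; apply: (coarse_obstruction _ emb) => k.
  exists (predual_family R k); split; last exact: predual_family_separated.
    by exists (Num.sqrt k%:R) => b s; exact: predual_family_bound.
  move=> b s t /(predual_family_interlaced R b)/le_trans; apply.
  by rewrite ler1n.
exists (JT_family R k); split; last exact: JT_family_separated.
  by exists (Num.sqrt k%:R) => b s; exact: JT_family_bound.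
exact: JT_family_interlaced.
Qed.
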